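(* The Hurewicz Conjecture for groups is true; that is, each metrizable topological group $G$ which is Hurewicz-bounded is a (topological) subgroup of some $\sigma$-compact topological group (i.e., $G$ is isomorphic as a topological group to a subgroup, with the subspace topology, of a $\sigma$-compact topological group).
   Context: A topological group $(G,\cdot)$ is Hurewicz-bounded if for each sequence $(U_n)_{n\in\mathbb{N}}$ of neighborhoods of the unit of $G$ there exist finite sets $F_n\subseteq G$, $n\in\mathbb{N}$, such that for each $g\in G$, $g\in F_n\cdot U_n$ for all but finitely many $n$, where $A\cdot B=\{a\cdot b: a\in A,\ b\in B\}$. A topological group is $\sigma$-compact if it is a union of countably many compact subsets. *)

(* Defs.v *)
From HB Require Import structures.
From mathcomp Require Import all_boot all_order all_algebra.
From mathcomp Require Import all_classical all_reals topology.

Set Implicit Arguments.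
Unset Strict Implicit.
Unset Printing Implicit Defensive.

Local Open Scope classical_set_scope.
Local Open Scope group_scope.

HB.structure Definition PreTopologicalGroup :=
  {G of Topological G & Group G}.

HB.mixin Record PreTopologicalGroup_isTopologicalGroup G
    & PreTopologicalGroup G := {
  mulg_continuous : continuous (fun x : G * G => x.1 * x.2) ;
  invg_continuous : continuous (fun x : G => x^-1) ;
}.

(* No separation axiom is part of the structure. *)
#[short(type="topologicalGroupType")]
HB.structure Definition TopologicalGroup :=
  {G of PreTopologicalGroup G & PreTopologicalGroup_isTopologicalGroup G}.

(* The topology of T is the one induced by the distance d; nonnegativity of d
   follows from the three axioms. *)
Definition metrizable (R : realType) (T : topologicalType) : Prop :=
  exists d : T -> T -> R,
    [/\ forall x y, d x y = 0%R <-> x = y,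
        forall x y, d x y = d y x,
        forall x y z, (d x z <= d x y + d y z)%R
      & forall x : T,
          nbhs x = nbhs_ball_ (fun c r => [set y | (d c y < r)%R]) x].

(* Neighborhoods are not required to be open. *)
Definition hurewicz_bounded (G : topologicalGroupType) : Prop :=
  forall U : nat -> set G, (forall n, nbhs (1 : G) (U n)) ->
  exists F : nat -> set G, (forall n, finite_set (F n)) /\
    forall g : G, \forall n \near \oo, [set a * b | a in F n & b in U n] g.

Definition sigma_compact (T : topologicalType) : Prop :=
  exists K : nat -> set T,
    (forall n, compact (K n)) /\ \bigcup_n K n = [set: T].

(* S, seen as a type, carries the subspace topology of H; multiplicativity of
   the isomorphism f is expressed in H, through the inclusion of S. *)
Definition isomorphic_to_subgroup (G H : topologicalGroupType) (S : set H) :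
    Prop :=
  group_closed [in S] /\
  exists (f : G -> S) (g : S -> G),
    [/\ cancel f g, cancel g f, continuous f, continuous g
      & {morph (fun x => set_val (f x)) : x y / x * y}].

(* Main.v *)
(* Let B be a countable base at the unit and let F be the finite sets given by
   Hurewicz-boundedness for B. The sets L_m of those g such that both g and g^-1
   lie in F_n B_n for all n >= m cover G, and each is precompact for the left and
   for the right uniformity, hence for their join. Products of such sets are again
   precompact, so G is a union of symmetric precompact sets M_m with
   M_m M_m contained in M_(m+1). The two-sided Cauchy sequences that stay in some
   M_m form a topological group, a subgroup of the Raikov completion except that
   null sequences are not factored out; it contains G as the constant sequences,
   and the sequences staying in a given M_m form a compact set. *)
Require Import Defs.
From HB Require Import structures.
From mathcomp Require Import all_boot all_order all_algebra.
From mathcomp Require Import all_classical all_reals topology.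

Set Implicit Arguments.
Unset Strict Implicit.
Unset Printing Implicit Defensive.

Import Order.TTheory GRing.Theory Num.Theory.

Local Open Scope classical_set_scope.
Local Open Scope group_scope.

(** * Finite intersections in filters, finite unions in ultrafilters *)

Lemma filter_finite_bigI (I : choiceType) (T : Type) (F : set_system T)
    (D : set I) (A : I -> set T) : Filter F -> finite_set D ->
  (forall i, D i -> F (A i)) -> F (\bigcap_(i in D) A i).
Proof.
move=> FF /finite_fsetP[E ->] FA; apply: filter_bigI => i iE; exact: FA.
Qed.

Lemma ultra_finite_bigU (I : choiceType) (T : Type) (F : set_system T)
    (D : set I) (A : I -> set T) : UltraFilter F -> finite_set D ->
  F (\bigcup_(i in D) A i) -> exists2 i, D i & F (A i).
Proof.
move=> FU finD FDA; apply: contrapT => nFA.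
have /filter_ex[x [[i Di Aix] nAx]] :
    F ((\bigcup_(i in D) A i) `&` (\bigcap_(i in D) ~` A i)).
  apply: filterI => //; apply: filter_finite_bigI => // i Di.
  have [FAi|//] := in_ultra_setVsetC (A i) FU.
  by case: nFA; exists i.
exact: nAx Aix.
Qed.

(** * The two-sided uniformity and its precompact sets *)

Section TwoSidedUniformity.
Variable G : topologicalGroupType.
Implicit Types (U V W A B F : set G) (a b c g x y : G).

Lemma mulg_left_continuous a : continuous (fun x : G => a * x).
Proof.
move=> x; apply: (@continuous_comp _ _ _ (fun x => (a, x)) (fun p => p.1 * p.2)).
  by apply: cvg_pair => //=; exact: cvg_cst.
exact: mulg_continuous.
Qed.

Lemma mulg_right_continuous a : continuous (fun x : G => x * a).
Proof.
move=> x; apply: (@continuous_comp _ _ _ (fun x => (x, a)) (fun p => p.1 * p.2)).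
  by apply: cvg_pair => //=; exact: cvg_cst.
exact: mulg_continuous.
Qed.

Lemma nbhs1_conj a U : nbhs (1 : G) U -> nbhs (1 : G) [set w | U (a^-1 * w * a)].
Proof.
move=> U1.
have := @mulg_right_continuous a (a^-1 * 1) U.
rewrite mulg1 mulVg => /(_ U1) Ua.
by have := @mulg_left_continuous a^-1 1 _; rewrite mulg1 => /(_ _ Ua).
Qed.

Lemma nbhs1_mul U : nbhs (1 : G) U ->
  exists2 V, nbhs (1 : G) V & forall x y, V x -> V y -> U (x * y).
Proof.
move=> U1; have := @mulg_continuous G (1, 1) U.
rewrite mulg1 => /(_ U1) [[A B] [/= A1 B1] AB].
exists (A `&` B); first exact: filterI.
by move=> x y [Ax _] [_ By]; exact: (AB (x, y)).
Qed.

Lemma nbhs1_inv U : nbhs (1 : G) U -> nbhs (1 : G) [set x | U x^-1].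
Proof. by move=> U1; apply: (@invg_continuous G 1); rewrite invg1. Qed.

Lemma nbhs1_root U : nbhs (1 : G) U ->
  exists V, [/\ nbhs (1 : G) V, forall x, V x -> V x^-1,
    V `<=` U & forall x y, V x -> V y -> U (x * y)].
Proof.
move=> U1; have [V V1 VU] := nbhs1_mul U1.
exists (V `&` [set x | V x^-1]); split.
- by apply: filterI => //; exact: nbhs1_inv.
- by move=> x [Vx Vx'] /=; split => //=; rewrite invgK.
- by move=> x [Vx _]; rewrite -(mulg1 x); apply: VU => //; exact: nbhs_singleton.
- by move=> x y [Vx _] [Vy _]; exact: VU.
Qed.

(** Basic entourage of the join of the left and right uniformities. Since [U] need not be symmetric,
    neither is this relation. *)
Definition bi_close U a b := U (a^-1 * b) /\ U (a * b^-1).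

Lemma bi_closexx U a : nbhs (1 : G) U -> bi_close U a a.
Proof. by move=> /nbhs_singleton U1; split; rewrite ?mulVg ?mulgV. Qed.

Lemma bi_closeS U V a b : U `<=` V -> bi_close U a b -> bi_close V a b.
Proof. by move=> UV [Uab Uba]; split; exact: UV. Qed.

Lemma bi_close_root U : nbhs (1 : G) U ->
  exists V, [/\ nbhs (1 : G) V,
    forall a b, bi_close V a b -> bi_close V b a
    & forall b a c, bi_close V a b -> bi_close V b c -> bi_close U a c].
Proof.
move=> /nbhs1_root[V [V1 Vinv _ VV]]; exists V; split=> //.
- move=> a b [Vab Vba]; split.
  + by rewrite -(invgK a) -invgM; exact: Vinv.
  + by rewrite -(invgK b) -invgM; exact: Vinv.
- move=> b a c [Vab Vba] [Vbc Vcb]; split.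
  + by rewrite -(mulVKg b c) mulgA; exact: VV.
  + by rewrite -(mulgVK b a) -mulgA; exact: VV.
Qed.

(** Together with [nbhs_bi_close]: the two-sided uniformity induces the topology of [G]. *)
Lemma near_bi_close U c : nbhs (1 : G) U -> \forall x \near c, bi_close U c x.
Proof.
move=> U1; apply: filterI.
  by apply: (@mulg_left_continuous c^-1 c U); rewrite mulVg.
have /(@mulg_left_continuous c) : nbhs (c * c^-1) U by rewrite mulgV.
exact: (@invg_continuous G c).
Qed.

Lemma nbhs_bi_close A c : nbhs c A ->
  exists2 U, nbhs (1 : G) U & forall x, bi_close U c x -> A x.
Proof.
move=> Ac; exists [set u | A (c * u)].
  by apply: (@mulg_left_continuous c 1 A); rewrite mulg1.
by move=> x [/= + _]; rewrite mulVKg.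
Qed.

(* Centres are taken in A so that, in compact_level, the limit sequence made of
   such centres stays in the given level. *)
Definition bi_precompact A := forall U, nbhs (1 : G) U ->
  exists F, [/\ finite_set F, F `<=` A
    & forall a, A a -> exists2 f, F f & bi_close U f a].

Lemma bi_precompact1 : bi_precompact [set 1].
Proof.
move=> U U1; exists [set 1]; split=> // a ->.
by exists 1 => //; exact: bi_closexx.
Qed.

Lemma bi_precompactU A B :
  bi_precompact A -> bi_precompact B -> bi_precompact (A `|` B).
Proof.
move=> tA tB U U1; have [E [finE EA cE]] := tA U U1.
have [F [finF FB cF]] := tB U U1.
exists (E `|` F); split; first by rewrite finite_setU.
  exact: setUSS.
by move=> a [/cE|/cF] [f ? ?]; exists f => //; [left|right].
Qed.

(** Conjugation by each of finitely many centres [f] is continuous at 1. Conjugating by [a] differs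
    from it by conjugation with a small element: [f^-1 * a] in one case, [f * a^-1] in the other. *)
Lemma bi_precompact_conj A U : bi_precompact A -> nbhs (1 : G) U ->
  exists2 W, nbhs (1 : G) W & forall a w, A a -> W w ->
    U (a^-1 * w * a) /\ U (a * w * a^-1).
Proof.
move=> tA /nbhs1_root[V [V1 Vinv _ VU]].
have [Y [Y1 Yinv YV YY]] := nbhs1_root V1.
have [F [finF _ cF]] := tA Y Y1.
exists (\bigcap_(f in F) ([set w | Y (f^-1 * w * f)] `&`
                          [set w | Y (f^-1^-1 * w * f^-1)])).
  apply: filter_finite_bigI => // f _.
  by apply: filterI; exact: nbhs1_conj.
move=> a w /cF[f Ff [Yfa Yaf]] /(_ f Ff) [/= Yw Yw']; rewrite invgK in Yw'.
split.
  have -> : a^-1 * w * a = (f^-1 * a)^-1 * ((f^-1 * w * f) * (f^-1 * a)).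
    by rewrite invgM invgK !mulgA !mulgK.
  by apply: VU; [exact/YV/Yinv|exact: YY].
have -> : a * w * a^-1 = (f * a^-1)^-1 * ((f * w * f^-1) * (f * a^-1)).
  by rewrite invgM invgK !mulgA !mulgVK.
by apply: VU; [exact/YV/Yinv|exact: YY].
Qed.

(* Multiplication is uniformly continuous on a bi-precompact set, although in
   general not on G. *)
Lemma bi_close_mul A U : bi_precompact A -> nbhs (1 : G) U ->
  exists2 W, nbhs (1 : G) W & forall a b a' b', A a -> A b ->
    bi_close W a a' -> bi_close W b b' -> bi_close U (a * b) (a' * b').
Proof.
move=> tA /nbhs1_root[V [V1 Vinv VU VV]].
have [W W1 cW] := bi_precompact_conj tA V1.
exists (W `&` V); first exact: filterI.
move=> a b a' b' Aa Ab [[Wa _] [Wa' Va']] [[_ Vb] [Wb' _]]; split.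
  (* The error in the first factor is conjugated by [b], which [W] controls uniformly for [b] in
     [A]. *)
  have -> : (a * b)^-1 * (a' * b') = (b^-1 * (a^-1 * a') * b) * (b^-1 * b').
    by rewrite invgM !mulgA mulgK.
  by apply: VV => //; exact: (cW b _ Ab Wa).1.
have -> : a * b * (a' * b')^-1 = (a * (b * b'^-1) * a^-1) * (a * a'^-1).
  by rewrite invgM !mulgA mulgVK.
by apply: VV => //; exact: (cW a _ Aa Wb').2.
Qed.

Lemma bi_close_inv U a b : bi_close U a b -> bi_close U a^-1 b^-1.
Proof. by move=> [Uab Uba]; split; rewrite ?invgK. Qed.

(** Products of centres serve as centres: [bi_close_mul] wants its unprimed points in [A], and the
    centres lie there. *)
Lemma bi_precompactM A : bi_precompact A ->
  bi_precompact [set a * b | a in A & b in A].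
Proof.
move=> tA U U1; have [W W1 WU] := bi_close_mul tA U1.
have [F [finF FA cF]] := tA W W1.
exists [set a * b | a in F & b in F]; split; first exact: finite_image2.
  by move=> _ [a /FA Aa [b /FA Ab <-]]; exists a => //; exists b.
move=> _ [a /cF[f Ff fa] [b /cF[h Fh hb] <-]].
exists (f * h); first by exists f => //; exists h.
by apply: WU => //; exact: FA.
Qed.

Definition bi_cauchy (x : nat -> G) := forall U, nbhs (1 : G) U ->
  exists N, forall i j, (N <= i)%N -> (N <= j)%N -> bi_close U (x i) (x j).

Record filtration := Filtration {
  level :> nat -> set G;
  level_precompact : forall m, bi_precompact (level m);
  level1 : forall m, level m 1;
  levelV : forall m x, level m x -> level m x^-1;
  levelM : forall m x y, level m x -> level m y -> level m.+1 (x * y);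
  level_cover : forall x, exists m, level m x }.

Lemma level_le (M : filtration) m n x : (m <= n)%N -> M m x -> M n x.
Proof.
move=> /subnK <-; elim: (n - m)%N => [//|k IH] /IH Mx.
by rewrite addSn -(mulg1 x); apply: levelM => //; exact: level1.
Qed.

(** Staying in one level makes termwise products Cauchy again, by [bi_close_mul], and cuts the
    completion into countably many pieces. *)
Record completion (M : filtration) := Completion {
  cseq :> nat -> G;
  cseq_cauchy : bi_cauchy cseq;
  cseq_level : exists m, forall n, M m (cseq n) }.

End TwoSidedUniformity.

(** * The group of Cauchy sequences confined to a level *)

Section Completion.
Variables (G : topologicalGroupType) (M : filtration G).
Local Notation H := (completion M).
Implicit Types (x y z : H) (U V W : set G).

HB.instance Definition _ := gen_eqMixin H.
HB.instance Definition _ := gen_choiceMixin H.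

Lemma completionP x y : (forall n, x n = y n) -> x = y.
Proof.
case: x y => [x cx lx] [y cy ly] /= /funext xy.
by subst y; congr Completion; exact: Prop_irrelevance.
Qed.

Lemma completion_level2 x y :
  exists m, forall n, M m (x n) /\ M m (y n).
Proof.
have [[m mx] [k ky]] := (cseq_level x, cseq_level y).
exists (maxn m k) => n; split.
  exact: level_le (leq_maxl _ _) (mx n).
exact: level_le (leq_maxr _ _) (ky n).
Qed.

Lemma const_cauchy (g : G) : bi_cauchy (fun=> g).
Proof. by move=> U U1; exists 0%N => i j _ _; exact: bi_closexx. Qed.

Lemma const_level (g : G) : exists m, forall n : nat, M m g.
Proof. by have [m mg] := level_cover M g; exists m. Qed.

Definition completion_const (g : G) : H :=
  Completion (const_cauchy g) (const_level g).

Lemma inv_cauchy x : bi_cauchy (fun n => (x n)^-1).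
Proof.
move=> U /(cseq_cauchy x)[N NP]; exists N => i j iN jN.
by apply: bi_close_inv; exact: NP.
Qed.

Lemma inv_level x : exists m, forall n, M m (x n)^-1.
Proof. by have [m mx] := cseq_level x; exists m => n; exact: levelV. Qed.

Definition completion_inv x : H := Completion (@inv_cauchy x) (inv_level x).

Lemma mul_cauchy x y : bi_cauchy (fun n => x n * y n).
Proof.
move=> U U1; have [m mxy] := completion_level2 x y.
have [W W1 WU] := bi_close_mul (@level_precompact _ M m) U1.
have [N NP] := cseq_cauchy x W1; have [K KP] := cseq_cauchy y W1.
exists (maxn N K) => i j; rewrite !geq_max => /andP[Ni Ki] /andP[Nj Kj].
by apply: WU; [exact: (mxy i).1|exact: (mxy i).2|exact: NP|exact: KP].
Qed.

Lemma mul_level x y : exists m, forall n, M m (x n * y n).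
Proof.
have [m mxy] := completion_level2 x y.
by exists m.+1 => n; have [mx my] := mxy n; exact: levelM.
Qed.

Definition completion_mul x y : H :=
  Completion (@mul_cauchy x y) (mul_level x y).

(** Equality is termwise equality of sequences, so the group laws come directly from [G]. *)
Fact completion_mulA : associative completion_mul.
Proof. by move=> x y z; apply: completionP => n /=; rewrite mulgA. Qed.

Fact completion_mul1g : left_id (completion_const 1) completion_mul.
Proof. by move=> x; apply: completionP => n /=; rewrite mul1g. Qed.

Fact completion_mulg1 : right_id (completion_const 1) completion_mul.
Proof. by move=> x; apply: completionP => n /=; rewrite mulg1. Qed.

Fact completion_mulVg :
  left_inverse (completion_const 1) completion_inv completion_mul.
Proof. by move=> x; apply: completionP => n /=; rewrite mulVg. Qed.

Fact completion_mulgV :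
  right_inverse (completion_const 1) completion_inv completion_mul.
Proof. by move=> x; apply: completionP => n /=; rewrite mulgV. Qed.

HB.instance Definition _ := isGroup.Build H completion_mulA completion_mul1g
  completion_mulg1 completion_mulVg completion_mulgV.

(** * The group topology on the completion *)

Definition ev_close U x y := \forall n \near \oo, bi_close U (x n) (y n).

(* Null sequences are not factored out, so this topology need not be Hausdorff. *)
Definition completion_nbhs x : set_system H :=
  [set A | exists2 U, nbhs (1 : G) U & forall y, ev_close U x y -> A y].

HB.instance Definition _ := hasNbhs.Build H completion_nbhs.

Lemma ev_closexx U x : nbhs (1 : G) U -> ev_close U x x.
Proof. by move=> U1; apply: nearW => n; exact: bi_closexx. Qed.

Fact completion_nbhs_filter x : ProperFilter (nbhs x).
Proof.
apply: Build_ProperFilter_ex => [A [U U1 UA]|].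
  by exists x; apply: UA; exact: ev_closexx.
split; first by exists setT => //; exact: filterT.
  move=> A B [U U1 UA] [V V1 VB].
  exists (U `&` V); first exact: filterI.
  move=> y UVxy; split; [apply: UA|apply: VB]; apply: filterS UVxy => n.
    by apply: bi_closeS; exact: subIsetl.
  by apply: bi_closeS; exact: subIsetr.
by move=> A B AB [U U1 UA]; exists U => // y /UA /AB.
Qed.

Fact completion_nbhs_singleton x (A : set H) : nbhs x A -> A x.
Proof. by move=> [U U1]; apply; exact: ev_closexx. Qed.

Fact completion_nbhs_nbhs x (A : set H) : nbhs x A -> nbhs x (nbhs^~ A).
Proof.
move=> [U U1 UA]; have [V [V1 _ Vtrans]] := bi_close_root U1.
exists V => // y Vxy; exists V => // z Vyz; apply: UA.
by apply: filterS2 Vxy Vyz => n; exact: Vtrans.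
Qed.

HB.instance Definition _ := Nbhs_isNbhsTopological.Build H
  completion_nbhs_filter completion_nbhs_singleton completion_nbhs_nbhs.

Lemma nbhs_ev_close U x : nbhs (1 : G) U -> nbhs x (ev_close U x).
Proof. by move=> U1; exists U. Qed.

(** Only [x] and [y] have to share a level: [bi_close_mul] puts no level condition on the nearby
    [x'] and [y'], which may lie in higher levels. *)
Fact completion_mulg_continuous : continuous (fun p : H * H => p.1 * p.2).
Proof.
move=> [x y] A [U U1 UA].
have [m mxy] := completion_level2 x y.
have [W W1 WU] := bi_close_mul (@level_precompact _ M m) U1.
exists (ev_close W x, ev_close W y); first by split; exact: nbhs_ev_close.
move=> [x' y'] [/= Wx Wy]; apply: UA => /=.
by apply: filterS2 Wx Wy => n; apply: WU; [exact: (mxy n).1|exact: (mxy n).2].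
Qed.

Fact completion_invg_continuous : continuous (fun x : H => x^-1).
Proof.
move=> x A [U U1 UA]; exists U => // y Uxy; apply: UA.
by apply: filterS Uxy => n; exact: bi_close_inv.
Qed.

HB.instance Definition _ := PreTopologicalGroup_isTopologicalGroup.Build H
  completion_mulg_continuous completion_invg_continuous.

(** An ultrafilter on the level selects for each [k] a centre [f k] to which most sequences are
    eventually [B k]-close. The sequence of these centres is Cauchy and is a limit. *)
Lemma compact_level (B : nat -> set G) m :
  (forall n, nbhs (1 : G) (B n)) ->
  (forall U, nbhs (1 : G) U -> exists N, forall n, (N <= n)%N -> B n `<=` U) ->
  compact [set x : H | forall n, M m (x n)].
Proof.
move=> B1 Bbase; rewrite compact_ultra => F FU FK.
have centre k : exists f, M m f /\
    F [set y : H | \forall n \near \oo, bi_close (B k) f (y n)].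
  have [V [V1 _ Vtrans]] := bi_close_root (B1 k).
  have [E [finE EM cE]] := @level_precompact _ M m V V1.
  have [f /EM Mf Ff] : exists2 f, E f &
      F [set y : H | \forall n \near \oo, bi_close (B k) f (y n)].
    (* Some centre is close to a term [y N] from which on [y] varies within [V]; so finitely many
       sets, one per centre, cover the level. *)
    apply: ultra_finite_bigU => //; apply: filterS FK => y My.
    have [N NP] := cseq_cauchy y V1.
    have [f Ef fy] := cE _ (My N); exists f => //.
    by exists N => // n /= Nn; apply: Vtrans fy _; exact: NP.
  by exists f.
have [f fP] := choice centre.
have f_cauchy : bi_cauchy f.
  move=> U U1; have [V [V1 Vsym Vtrans]] := bi_close_root U1.
  have [N NV] := Bbase V V1; exists N => i j Ni Nj.
  (* Two members of the ultrafilter share a sequence [y], and two eventual conditions share an index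
     [n]; [y n] links [f i] to [f j]. *)
  have [y [fiy fjy]] := filter_ex (filterI (fP i).2 (fP j).2).
  have [n [fiyn fjyn]] := filter_ex (filterI fiy fjy).
  apply: (Vtrans (y n)); first exact: bi_closeS (NV i Ni) _.
  by apply: Vsym; exact: bi_closeS (NV j Nj) _.
pose x : H := Completion f_cauchy (ex_intro _ m (fun n => (fP n).1)).
exists x; split; first by move=> n; exact: (fP n).1.
move=> A [U U1 UA]; have [V [V1 _ Vtrans]] := bi_close_root U1.
have [N NV] := Bbase V V1; have [K KP] := f_cauchy V V1.
(* [N] puts [B k] inside [V], and from [K] on the centres are [V]-close, so [f k] links [x n] to
   [y n]. *)
pose k := maxn N K; have Kk : (K <= k)%N by exact: leq_maxr.
apply: filterS (fP k).2 => y; move=> fky; apply: UA.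
have near_K : \forall n \near \oo, (K <= n)%N by exists K.
apply: filterS2 fky near_K => n fkyn Kn; apply: (Vtrans (f k)); first exact: KP.
by apply: bi_closeS fkyn; apply: NV; exact: leq_maxl.
Qed.

Lemma sigma_compact_completion (B : nat -> set G) :
  (forall n, nbhs (1 : G) (B n)) ->
  (forall U, nbhs (1 : G) U -> exists N, forall n, (N <= n)%N -> B n `<=` U) ->
  sigma_compact H.
Proof.
move=> B1 Bbase; exists (fun m => [set x : H | forall n, M m (x n)]); split.
  by move=> m; exact: compact_level Bbase.
by apply/seteqP; split => // x _; have [m mx] := cseq_level x; exists m.
Qed.

(** * The embedding by constant sequences *)

Lemma completion_const_continuous : continuous completion_const.
Proof.
move=> g A [U U1 UA]; have := near_bi_close g U1.
by apply: filterS => h gh; apply: UA; apply: nearW.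
Qed.

Lemma isomorphic_to_range_const :
  isomorphic_to_subgroup G (range completion_const).
Proof.
split.
  split; first by apply/mem_set; exists 1.
  move=> _ _ /set_mem[g _ <-] /set_mem[h _ <-]; apply/mem_set.
  by exists (g / h) => //; apply: completionP.
pose f g : range completion_const :=
  SigSub (mem_set (imageT completion_const g)).
(* Elements of the range are constant sequences, so any index would serve. *)
pose e (s : range completion_const) : G := cseq (set_val s) 0%N.
exists f, e; have eK : cancel e f.
  move=> s; apply: val_inj => /=.
  by have [g _ gs] := set_valP s; rewrite /e set_valE -gs.
split=> //.
- apply: continuous_comp_initial; exact: completion_const_continuous.
- move=> s A /nbhs_bi_close[U U1 UA].
  have : nbhs s (set_val @^-1` ev_close U (set_val s)).
    exact: (@initial_continuous _ _ set_val s) (nbhs_ev_close _ U1).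
  (* Once both sequences are seen to be constant, closeness at a single index is closeness of their
     values. *)
  apply: filterS => t; rewrite /= -{1}(eK s) -{1}(eK t) => /filter_ex[n st].
  exact: UA.
- by move=> g h; apply: completionP.
Qed.

End Completion.

(** * From Hurewicz-boundedness to precompact levels *)

Section Hurewicz.
Variables (G : topologicalGroupType) (B : nat -> set G).
Hypothesis B1 : forall n, nbhs (1 : G) (B n).
Hypothesis Bbase : forall U : set G, nbhs (1 : G) U ->
  exists N, forall n, (N <= n)%N -> B n `<=` U.

(** For large [n], each [g] in the set has [f^-1 * g] and [g * h] in a small symmetric [V] for some
    [f], [h] in [F n]. Points sharing the pair [(f, h)] are close on both sides, and there are
    finitely many pairs. *)
Lemma bi_precompact_hurewicz (F : nat -> set G) m :
  (forall n, finite_set (F n)) ->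
  bi_precompact [set g | forall n, (m <= n)%N ->
    [set a * b | a in F n & b in B n] g /\
    [set a * b | a in F n & b in B n] g^-1].
Proof.
move=> finF U /nbhs1_root[V [V1 Vinv _ VV]].
have [N NV] := Bbase V1; pose n := maxn m N.
have {}NV : B n `<=` V by apply: NV; exact: leq_maxr.
set L := [set g | _].
pose P (p : G * G) := [set c | [/\ L c, V (p.1^-1 * c) & V (c * p.2)]].
(* One representative per nonempty cell [P p]. Discarding empty cells keeps out the default 1, which
   might lie outside [L]. *)
exists ((fun p => xget 1 (P p)) @` ([set p | P p !=set0] `&` (F n `*` F n))); split.
- apply: finite_image; apply: sub_finite_set (finite_setX (finF n) (finF n)).
  exact: subIsetr.
- by move=> _ [p [[c Pc] _] <-]; have [] := xgetPex 1 (ex_intro _ c Pc).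
move=> g Lg.
have [[f Ff [u /NV Vu fug]] [h Fh [v /NV Vv hvg]]] := Lg n (leq_maxl _ _).
have Pg : P (f, h) g.
  split=> //=; first by rewrite -fug mulKg.
  by rewrite -(invgK g) -hvg invgM mulgVK; exact: Vinv.
exists (xget 1 (P (f, h))).
  by exists (f, h) => //; split => //; exists g.
have := xgetPex 1 (ex_intro _ g Pg); set c := xget _ _ => -[_ /= Vfc Vch].
have [_ /= Vfg Vgh] := Pg; split.
  have -> : c^-1 * g = (f^-1 * c)^-1 * (f^-1 * g).
    by rewrite invgM invgK !mulgA mulgK.
  by apply: VV => //; exact: Vinv.
have -> : c * g^-1 = (c * h) * (g * h)^-1 by rewrite mulgKA.
by apply: VV => //; exact: Vinv.
Qed.

Lemma hurewicz_filtration : hurewicz_bounded G -> inhabited (filtration G).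
Proof.
move=> /(_ _ B1)[F [finF FB]].
pose L m := [set g : G | forall n, (m <= n)%N ->
    [set a * b | a in F n & b in B n] g /\
    [set a * b | a in F n & b in B n] g^-1].
have L_precompact m : bi_precompact (L m) by exact: bi_precompact_hurewicz.
have LV m g : L m g -> L m g^-1.
  by move=> Lg n /Lg[? ?]; rewrite invgK.
have L_cover g : exists m, L m g.
  have [N _ NP] := filterI (FB g) (FB g^-1).
  by exists N => n Nn; exact: NP.
pose sq (A : set G) := [set a * b | a in A & b in A].
(* Squaring yields [levelM], and adjoining [L n] first makes the levels exhaust [G]. *)
pose M := fix M m := if m is n.+1 then sq (M n `|` L n) else [set (1 : G)].
have M1 m : M m 1.
  elim: m => //= m IH; exists 1; first by left.
  by exists 1; [left|rewrite mulg1].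
constructor; apply: (@Filtration _ M).
- elim=> [|m IH]; first exact: bi_precompact1.
  by apply: bi_precompactM; exact: bi_precompactU.
- exact: M1.
- elim=> [|m IH] x /=; first by move=> ->; rewrite invg1.
  have V y : (M m `|` L m) y -> (M m `|` L m) y^-1.
    by case=> [/IH|/LV] ?; [left|right].
  move=> [a /V Va [b /V Vb <-]]; exists b^-1 => //; exists a^-1 => //.
  by rewrite invgM.
- by move=> m x y Mx My; exists x; [left|exists y => //; left].
- move=> g; have [m Lg] := L_cover g; exists m.+1, g; first by right.
  by exists 1; [left|rewrite mulg1].
Qed.

End Hurewicz.

(** * Countable bases from a metric, and the conclusion *)

Lemma metrizable_countable_base (R : realType) (T : topologicalType) (x : T) :
  metrizable R T -> exists B : nat -> set T, (forall n, nbhs x (B n)) /\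
    forall U, nbhs x U -> exists N, forall n, (N <= n)%N -> B n `<=` U.
Proof.
move=> [d [d0 _ _ nbhsd]].
exists (fun n => [set y | (d x y < n.+1%:R^-1)%R]); rewrite nbhsd; split.
  by move=> n; exists n.+1%:R^-1%R => //=; rewrite invr_gt0 ltr0n.
(* For [n] at least the integer part of [e^-1], [n.+1] exceeds [e^-1]. *)
move=> U [e /= e0 eU]; exists (Num.truncn e^-1) => n en y /= dxy; apply: eU.
apply: lt_le_trans dxy _; rewrite -(invrK e) lef_pV2 ?posrE ?invr_gt0 ?ltr0n //.
by apply/ltW/(lt_le_trans (truncnS_gt _)); rewrite ler_nat.
Qed.

Theorem corollary4p3 (R : realType) (G : topologicalGroupType) :
  metrizable R G -> hurewicz_bounded G ->
  exists (H : topologicalGroupType) (S : set H),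
    sigma_compact H /\ isomorphic_to_subgroup G S.
Proof.
move=> /(@metrizable_countable_base _ _ 1)[B [B1 Bbase]].
move=> /(hurewicz_filtration B1 Bbase)[M].
exists (completion M), (range (completion_const M)); split.
  exact: sigma_compact_completion B1 Bbase.
exact: isomorphic_to_range_const.
Qed.
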